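(* Let $Q_2\subset\mathbb{R}^n$ be a bounded polyhedron, let $\check x\in\mathbb{R}^n\setminus Q_2$ and $\widehat x\in Q_2$, and let $\|\cdot\|$ be any norm on $\mathbb{R}^n$. Suppose the secondary normalization is $\|\pi\|\le 1$, i.e. for every $x'\notin Q_2$ the secondary separation procedure called on $(Q_2,x')$ returns the cut $\pi x\le\pi_0$ given by an optimal solution $(\pi,\pi_0)$ of $$\max_{\pi,\pi_0}\{\pi x'-\pi_0 : \pi x\le\pi_0\ \ \forall x\in Q_2,\ \|\pi\|\le 1\}.$$ Then the iterative method for the Fenchel sub-problem (described in the context) terminates after finitely many iterations and returns a cut associated with the directional normalization toward $\widehat x$.
   Context: **Cuts.** A cut is an inequality $\pi x\le\pi_0$ valid for $Q_2$ (i.e. satisfied by all points of $Q_2$); it separates a point $y$ from $Q_2$ if $\pi y>\pi_0$. A point is said to be on the cut if it satisfies $\pi x=\pi_0$. **Directional normalization.** The Fenchel separation problem for $\check x$ with directional normalization toward $\widehat x$ is $$\max_{\pi,\pi_0}\{\pi\check x-\pi_0 : \pi x\le\pi_0\ \ \forall x\in Q_2,\ |\pi(\widehat x-\check x)|\le 1\}.$$ A cut associated with the directional normalization toward $\widehat x$ is, up to positive scaling, an optimal solution of this problem; equivalently, it is a cut $\pi x\le\pi_0$ valid for $Q_2$, separating $\check x$ from $Q_2$, whose hyperplane $\pi x=\pi_0$ contains the point where the segment from $\check x$ to $\widehat x$ meets the frontier of $Q_2$ (the point of $Q_2$ on this segment closest to $\check x$). **Iterative method.** Input: $Q_2$, $\check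 x$, $\widehat x$. 1. Set $x'=\check x$. 2. While $x'\notin Q_2$: call the secondary separation procedure (the Fenchel separation problem solved with some other fixed normalization, called the secondary normalization) on $(Q_2,x')$ to obtain a cut $C$ separating $x'$ from $Q_2$; then replace $x'$ by the intersection point of the segment from $\check x$ to $\widehat x$ with the hyperplane of $C$. 3. Return the last cut $C$. *)

(* Defs.v *)
From HB Require Import structures.
From mathcomp Require Import all_boot all_order all_algebra.
From mathcomp Require Import all_classical all_reals all_analysis.

Set Implicit Arguments.
Unset Strict Implicit.
Unset Printing Implicit Defensive.

Import Order.TTheory GRing.Theory Num.Theory.
Import numFieldNormedType.Exports.

Local Open Scope classical_set_scope.
Local Open Scope ring_scope.

(* Points of R^n are column vectors; left-hand sides of linear inequalities   *)
(* are row vectors.                                                           *)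

Definition dotrc (R : realType) (n : nat) (p : 'rV[R]_n) (x : 'cV[R]_n) : R :=
  (p *m x) 0 0.

Definition polyhedron (R : realType) (n : nat) (Q : set 'cV[R]_n) : Prop :=
  exists (m : nat) (A : 'M[R]_(m, n)) (b : 'cV[R]_m),
    Q = [set x | forall i, (A *m x) i 0 <= b i 0].

(* An arbitrary norm on R^n, unrelated to the canonical (sup) norm `|_| that  *)
(* the library attaches to matrices.                                          *)
Record is_norm (R : realType) (n : nat) (N : 'rV[R]_n -> R) : Prop := IsNorm {
  is_norm_triangle : forall p q, N (p + q) <= N p + N q;
  is_norm_homogeneous : forall (a : R) p, N (a *: p) = `|a| * N p;
  is_norm_definite : forall p, N p = 0 -> p = 0
}.

(* The pair (p, p0) stands for the inequality p x <= p0. *)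
Definition cutineq (R : realType) (n : nat) : Type := ('rV[R]_n * R)%type.

Definition valid_cut (R : realType) (n : nat) (Q : set 'cV[R]_n)
    (C : cutineq R n) : Prop :=
  forall x, Q x -> dotrc C.1 x <= C.2.

Definition hyperplane (R : realType) (n : nat) (C : cutineq R n) :
    set 'cV[R]_n :=
  [set x | dotrc C.1 x = C.2].

(* C is an optimal solution of                                                *)
(*   max { p x - p0 : p z <= p0 for all z in Q, p in B },                     *)
(* where B is the set of normalized left-hand sides.                          *)
Definition fenchel_optimal (R : realType) (n : nat) (Q : set 'cV[R]_n)
    (B : set 'rV[R]_n) (x : 'cV[R]_n) (C : cutineq R n) : Prop :=
  [/\ valid_cut Q C, B C.1 &
    forall D : cutineq R n, valid_cut Q D -> B D.1 ->
      dotrc D.1 x - D.2 <= dotrc C.1 x - C.2].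

Definition norm_normalization (R : realType) (n : nat) (N : 'rV[R]_n -> R) :
    set 'rV[R]_n :=
  [set p | N p <= 1].

Definition directional_normalization (R : realType) (n : nat)
    (xc xh : 'cV[R]_n) : set 'rV[R]_n :=
  [set p | `|dotrc p (xh - xc)| <= 1].

Definition directional_cut (R : realType) (n : nat) (Q : set 'cV[R]_n)
    (xc xh : 'cV[R]_n) (C : cutineq R n) : Prop :=
  exists2 a : R, 0 < a &
    fenchel_optimal Q (directional_normalization xc xh) xc (a *: C.1, a * C.2).

Definition segm (R : realType) (n : nat) (x y : 'cV[R]_n) : set 'cV[R]_n :=
  [set z | exists t : R, 0 <= t <= 1 /\ z = x + t *: (y - x)].

(* Execution of the while loop of the iterative method, with sep the          *)
(* secondary separation procedure for Q: started at the current point x' with *)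
(* last computed cut C (None if there is none yet), the loop stops after      *)
(* exactly k iterations and its last cut is then C'. The next point exists    *)
(* only if the segment and the hyperplane meet in exactly one point; hence    *)
(* k and C' are determined by x' and C, and the absence of any (k, C') means  *)
(* that the execution either gets stuck or runs forever.                      *)
Inductive loop (R : realType) (n : nat) (Q : set 'cV[R]_n)
    (sep : 'cV[R]_n -> cutineq R n) (xc xh : 'cV[R]_n) :
    'cV[R]_n -> option (cutineq R n) -> nat -> option (cutineq R n) -> Prop :=
| loop_stop x' C :
    Q x' -> loop Q sep xc xh x' C 0 C
| loop_iter x' C x'' k C' :
    ~ Q x' ->
    segm xc xh `&` hyperplane (sep x') = [set x''] ->
    loop Q sep xc xh x'' (Some (sep x')) k C' ->
    loop Q sep xc xh x' C k.+1 C'.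

Definition iterative_method_returns (R : realType) (n : nat)
    (Q : set 'cV[R]_n) (sep : 'cV[R]_n -> cutineq R n) (xc xh : 'cV[R]_n)
    (k : nat) (C : cutineq R n) : Prop :=
  loop Q sep xc xh xc None k (Some C).

(* Main.v *)
Require Import Defs.
From HB Require Import structures.
From mathcomp Require Import all_boot all_order all_algebra.
From mathcomp Require Import all_classical all_reals all_analysis.
From mathcomp Require Import ring lra.
Import Order.TTheory GRing.Theory Num.Theory.
Import numFieldNormedType.Exports.
Set Implicit Arguments.
Unset Strict Implicit.

Local Open Scope classical_set_scope.
Local Open Scope ring_scope.

(* On the segment x(t) = xc + t (xh - xc), the optimal secondary value f(t) is
   convex, and the cut at t is an affine minorant of f that is exact at t, so
   the method is Newton's iteration for the zero T at which the segment enters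
   Q2. Every step but the first is bounded below as long as t stays away from
   T: a row of the polyhedron tight at T gives f(t) >= c (T - t), and all
   the cuts have violation at most f(0) at xc. Close to T the optimal cut is
   tight at x(T), so the next iterate is x(T) itself: by Farkas' lemma the
   cut is a nonnegative combination of rows, and the rows that are slack at
   x(T) cost more than the normalization gains from them. Finally, a valid cut
   tight at x(T) and violated at xc is optimal for the directional
   normalization after scaling. *)

(** * Farkas' lemma, homogeneous and affine *)

Lemma mulmx_line (R : realType) (m n : nat) (A : 'M[R]_(m, n))
    (x y : 'cV[R]_n) (s : R) i :
  (A *m (x + s *: y)) i 0 = (A *m x) i 0 + s * (A *m y) i 0.
Proof. by rewrite mulmxDr -scalemxAr mxE [X in _ + X = _]mxE. Qed.

(* Induction on the rows (Bartl): if the last m rows do not imply c, a point z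
   refuting this is scaled to a z = 1 on the first row a, and every row (and c)
   is projected along z, i.e. composed with x |-> x - (a x) z. *)
Lemma farkas (R : realType) (m n : nat) (A : 'M[R]_(m, n)) (c : 'rV[R]_n) :
  (forall y : 'cV[R]_n, (forall i, (A *m y) i 0 <= 0) -> (c *m y) 0 0 <= 0) ->
  exists2 l : 'rV[R]_m, (forall i, 0 <= l 0 i) & c = l *m A.
Proof.
elim: m => [|m IHm] in A c *.
  move=> cP; exists 0; first by case.
  pose e j : 'cV[R]_n := delta_mx j 0.
  have cj j : (c *m e j) 0 0 = c 0 j by rewrite -colE mxE.
  rewrite mul0mx; apply/rowP => j; rewrite mxE; apply/le_anti/andP; split.
    by rewrite -cj; apply: cP; case.
  rewrite -cj -oppr_le0 [X in X <= _](_ : _ = (c *m - e j) 0 0).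
    by apply: cP; case.
  by rewrite mulmxN [RHS]mxE.
move: A; rewrite -[m.+1]/(1 + m)%N => A cP.
pose a := usubmx A; pose B := dsubmx A.
have AE : A = col_mx a B by rewrite vsubmxK.
have [cB|] := pselect (forall y : 'cV[R]_n,
    (forall i, (B *m y) i 0 <= 0) -> (c *m y) 0 0 <= 0).
  have [l l0 cE] := IHm B c cB; exists (row_mx 0 l).
    by move=> i; rewrite mxE; case: fintype.split => j; rewrite ?mxE.
  by rewrite AE mul_row_col mul0mx add0r.
move=> /existsNP[y /not_implyP[By /negP]]; rewrite -ltNge => cy.
have ay : 0 < (a *m y) 0 0.
  rewrite ltNge; apply/negP => ay; move: cy; rewrite ltNge => /negP; apply.
  apply: cP => i; rewrite AE mul_col_mx mxE.
  by case: fintype.split => j //; rewrite ord1.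
pose z := ((a *m y) 0 0)^-1 *: y.
have az : a *m z = 1%:M.
  by rewrite -scalemxAr {2}[a *m y]mx11_scalar scale_scalar_mx mulVf // gt_eqF.
have Bz i : (B *m z) i 0 <= 0.
  by rewrite -scalemxAr mxE mulr_ge0_le0 // invr_ge0 ltW.
have cz : 0 < (c *m z) 0 0.
  by rewrite -scalemxAr mxE mulr_gt0 // invr_gt0.
have [x Bx|l l0 cE] := IHm (B - B *m z *m a) (c - c *m z *m a).
  (* The corrected point lies on the hyperplane [a = 0], so the hypothesis on all rows applies to
     it. *)
  have := cP (x - z *m (a *m x)).
  rewrite !mulmxBr mulmxBl !mulmxA; apply => i.
  rewrite AE !mul_col_mx az mul1mx opp_col_mx add_col_mx subrr mxE.
  case: fintype.split => j; first by rewrite mxE.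
  by rewrite -mulmxBl; exact: Bx.
(* Undoing the projection collects all multiples of [a]; their total is nonnegative because
   [c z > 0] and [B z <= 0]. *)
exists (row_mx (c *m z - l *m (B *m z)) l).
  move=> i; rewrite mxE; case: fintype.split => j //.
  rewrite ord1 mxE [X in _ + X]mxE subr_ge0 (le_trans _ (ltW cz)) //.
  by rewrite mxE sumr_le0 // => k _; rewrite mulr_ge0_le0.
rewrite AE mul_row_col mulmxBl -[LHS](subrK (c *m z *m a)) cE mulmxBr !mulmxA.
by rewrite addrAC -addrA addrC.
Qed.

(** Homogenization: the homogeneous lemma is applied to pairs [(x, t)] with [A x <= t b] and
    [t >= 0]. For [t > 0] one rescales; for [t = 0], [x] is a recession direction, followed from the
    feasible point [x0]. *)
Lemma farkas_affine (R : realType) (m n : nat) (A : 'M[R]_(m, n))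
    (b : 'cV[R]_m) (c : 'rV[R]_n) (d : R) (x0 : 'cV[R]_n) :
  (forall i, (A *m x0) i 0 <= b i 0) ->
  (forall x : 'cV_n, (forall i, (A *m x) i 0 <= b i 0) -> (c *m x) 0 0 <= d) ->
  exists l : 'rV[R]_m,
    [/\ forall i, 0 <= l 0 i, c = l *m A & (l *m b) 0 0 <= d].
Proof.
move=> Ax0 cP.
have [y|l l0] := farkas (A := block_mx A (- b) 0 (- 1%:M))
    (c := row_mx c (- d%:M)).
  rewrite -[y]vsubmxK; move: (usubmx y) (dsubmx y) => x t.
  rewrite mul_block_col mul_row_col !mulNmx mul0mx mul1mx add0r => Ay.
  have t0 : 0 <= t 0 0.
    by have := Ay (rshift m 0); rewrite col_mxEd mxE oppr_le0.
  have {Ay}Ax i : (A *m x) i 0 <= b i 0 * t 0 0.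
    have := Ay (lshift 1 i); rewrite col_mxEu mxE [X in _ + X]mxE subr_le0.
    by rewrite [X in _ <= X -> _]mxE big_ord1.
  rewrite mxE [X in _ + X]mxE subr_le0 mul_scalar_mx [X in _ <= X]mxE.
  have [tp|] := ltP 0 (t 0 0).
    have scE k (v : 'cV[R]_k) i e :
        (((t 0 0)^-1 *: v) i 0 <= e) = (v i 0 <= e * t 0 0).
      by rewrite mxE ler_pdivrMl // mulrC.
    by rewrite -scE scalemxAr; apply: cP => i; rewrite -scalemxAr scE.
  move=> tn; have tE : t 0 0 = 0 by apply/le_anti/andP.
  rewrite tE mulr0 leNgt; apply/negP => cx.
  (* With this [s] the point [x0 + s x] has value [d + c x], which exceeds [d]. *)
  pose s := ((d - (c *m x0) 0 0) / (c *m x) 0 0 + 1).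
  have s0 : 0 <= s.
    by rewrite addr_ge0 // divr_ge0 ?subr_ge0 ?(cP x0) // ltW.
  have := cP (x0 + s *: x); rewrite (mulmx_line c).
  have -> : s * (c *m x) 0 0 = d - (c *m x0) 0 0 + (c *m x) 0 0.
    by rewrite mulrDl mul1r divfK // gt_eqF.
  have Axs i : (A *m (x0 + s *: x)) i 0 <= b i 0.
    rewrite mulmx_line; have := Ax i; rewrite tE mulr0 => Axi.
    by have := Ax0 i; have := mulr_ge0_le0 s0 Axi; lra.
  by move=> /(_ Axs); lra.
rewrite -[l]hsubmxK mul_row_block => /eq_row_mx[].
rewrite mulmx0 addr0 !mulmxN mulmx1 => cE dE.
exists (lsubmx l); split => //.
  by move=> i; rewrite mxE.
move/rowP/(_ 0): dE; rewrite !mxE mulr1n.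
have := l0 (rshift m 0); lra.
Qed.

(** * Violation of a cut, and arbitrary norms *)

Definition violation (R : realType) (n : nat) (C : cutineq R n)
    (x : 'cV[R]_n) : R :=
  dotrc C.1 x - C.2.

Lemma dotrcZl (R : realType) (n : nat) (a : R) (p : 'rV[R]_n) (x : 'cV[R]_n) :
  dotrc (a *: p) x = a * dotrc p x.
Proof. by rewrite /dotrc -scalemxAl mxE. Qed.

Lemma dotrc_mulmx (R : realType) (m n : nat) (l : 'rV[R]_m) (A : 'M[R]_(m, n))
    (x : 'cV[R]_n) :
  dotrc (l *m A) x = (l *m (A *m x)) 0 0.
Proof. by rewrite /dotrc mulmxA. Qed.

(** The triangle inequality for [p] and [-p] gives [0 <= 2 N p]. *)
Lemma norm_ge0 (R : realType) (n : nat) (N : 'rV[R]_n -> R) p :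
  is_norm N -> 0 <= N p.
Proof.
move=> [triN homN _].
have := triN p (-1 *: p); rewrite scaleN1r subrr -(scale0r p) -scaleN1r !homN.
rewrite normr0 mul0r normrN1; lra.
Qed.

Lemma norm_gt0 (R : realType) (n : nat) (N : 'rV[R]_n -> R) p :
  is_norm N -> p != 0 -> 0 < N p.
Proof.
move=> hN p0; rewrite lt_neqAle norm_ge0 // andbT eq_sym.
by apply: contra_neq p0 => /(is_norm_definite hN).
Qed.

Lemma norm_scale_ge0 (R : realType) (n : nat) (N : 'rV[R]_n -> R) a p :
  is_norm N -> 0 <= a -> N (a *: p) = a * N p.
Proof. by move=> hN a0; rewrite (is_norm_homogeneous hN) ger0_norm. Qed.

Lemma norm_sum_le (R : realType) (n m : nat) (N : 'rV[R]_n -> R)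
    (F : 'I_m -> 'rV[R]_n) :
  is_norm N -> N (\sum_i F i) <= \sum_i N (F i).
Proof.
move=> hN; elim/big_ind2: _ => //.
  by rewrite -(scale0r 0) (norm_scale_ge0 _ hN) // mul0r.
by move=> p a q b pa qb; apply: le_trans (is_norm_triangle hN _ _) (lerD pa qb).
Qed.

Lemma norm_sub_le (R : realType) (n : nat) (N : 'rV[R]_n -> R) p q :
  is_norm N -> N (p - q) <= N p + N q.
Proof.
move=> hN; apply: le_trans (is_norm_triangle hN _ _) _.
by rewrite -scaleN1r (is_norm_homogeneous hN) normrN1 mul1r.
Qed.

(** * Tightness of optimal cuts near the entry point *)

Lemma ler_mulmx_row (R : realType) (m : nat) (l : 'rV[R]_m) (u v : 'cV[R]_m) :
  (forall i, 0 <= l 0 i) -> (forall i, u i 0 <= v i 0) ->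
  (l *m u) 0 0 <= (l *m v) 0 0.
Proof.
by move=> l0 uv; rewrite !mxE ler_sum // => i _; rewrite ler_wpM2l.
Qed.

(* Dropping from C the multipliers mu of the rows slack at xs, then dividing by
   k to restore the normalization, yields a cut D competing with C; under the
   smallness condition it would be strictly better unless mu = 0. *)
Lemma optimal_cut_tight (R : realType) (m n : nat) (A : 'M[R]_(m, n))
    (b : 'cV[R]_m) (N : 'rV[R]_n -> R) (xs x : 'cV[R]_n) (C : cutineq R n) :
  is_norm N -> (forall i, (A *m xs) i 0 <= b i 0) ->
  fenchel_optimal [set z | forall i, (A *m z) i 0 <= b i 0]
    (norm_normalization N) x C ->
  (forall i, (A *m xs) i 0 < b i 0 ->
    N (row i A) * violation C x < b i 0 - (A *m x) i 0) ->
  violation C xs = 0.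
Proof.
move=> hN Axs [Cval CN Copt] slack.
have [l [l0 C1E lb]] := farkas_affine Axs Cval.
set v := violation C x in slack.
pose mu : 'rV_m := \row_i (if (A *m xs) i 0 < b i 0 then l 0 i else 0).
have mu0 i : 0 <= mu 0 i by rewrite mxE; case: ifP.
have lmu0 i : 0 <= (l - mu) 0 i.
  by rewrite mxE [X in _ + X]mxE subr_ge0 mxE; case: ifP.
(* As [N C.1 <= 1], this [k] bounds the norm of [(l - mu) *m A]. *)
pose k := 1 + \sum_i mu 0 i * N (row i A).
have k1 : 1 <= k.
  by rewrite lerDl sumr_ge0 // => i _; rewrite mulr_ge0 // norm_ge0.
have kp : 0 < k by lra.
have muN : N (mu *m A) <= \sum_i mu 0 i * N (row i A).
  rewrite mulmx_sum_row (le_trans (norm_sum_le _ hN)) // ler_sum // => i _.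
  by rewrite (norm_scale_ge0 _ hN).
have vE : v <= (l *m (A *m x)) 0 0 - (l *m b) 0 0.
  by rewrite /v /violation C1E dotrc_mulmx; lra.
have Dopt : ((l - mu) *m (A *m x)) 0 0 - ((l - mu) *m b) 0 0 <= k * v.
  have := Copt (k^-1 *: ((l - mu) *m A), k^-1 * ((l - mu) *m b) 0 0).
  rewrite /= dotrcZl dotrc_mulmx -mulrBr ler_pdivrMl //.
  apply => [z Az|].
    rewrite /= dotrcZl dotrc_mulmx ler_pM2l ?invr_gt0 //.
    exact: ler_mulmx_row.
  rewrite /norm_normalization /= (norm_scale_ge0 _ hN) ?invr_ge0 ?(ltW kp) //.
  rewrite ler_pdivrMl // mulr1 mulmxBl -C1E.
  by rewrite (le_trans (norm_sub_le _ _ hN)) // lerD.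
(* Combining [vE] and [Dopt] shows that a sum of nonnegative terms is at most 0, so each term
   vanishes; on slack rows the factor of [mu] is positive. *)
have mu_eq0 i : mu 0 i = 0.
  have term_ge0 j : 0 <= mu 0 j * (b j 0 - (A *m x) j 0 - N (row j A) * v).
    rewrite mxE; case: ifP => [/slack sj|]; last by rewrite mul0r.
    by rewrite mulr_ge0 // subr_ge0 ltW.
  have sum0 : \sum_j mu 0 j * (b j 0 - (A *m x) j 0 - N (row j A) * v) <= 0.
    under eq_bigr => j _ do rewrite mulrBr mulrBr mulrA.
    rewrite !sumrB -mulr_suml.
    have BE u : ((l - mu) *m u) 0 0 = (l *m u) 0 0 - \sum_j mu 0 j * u j 0.
      by rewrite mulmxBl mxE [X in _ + X]mxE [X in _ - X]mxE.
    by move: Dopt; rewrite !BE mulrDl mul1r; lra.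
  have {sum0} : mu 0 i * (b i 0 - (A *m x) i 0 - N (row i A) * v) = 0.
    have : \sum_j mu 0 j * (b j 0 - (A *m x) j 0 - N (row j A) * v) = 0.
      by apply/le_anti; rewrite sum0 sumr_ge0.
    by move=> /psumr_eq0P; apply.
  move=> /eqP; rewrite mulf_eq0 => /orP[/eqP//|/eqP s0].
  by rewrite mxE; case: ifP => // /slack; lra.
have lE : (l *m (A *m xs)) 0 0 = (l *m b) 0 0.
  rewrite mxE [RHS]mxE; apply: eq_bigr => i _.
  have := mu_eq0 i; rewrite mxE; case: ltP => [_ ->|bA _].
    by rewrite !mul0r.
  by congr (_ * _); apply/le_anti; rewrite Axs bA.
apply/eqP; rewrite /violation subr_eq0 eq_le Cval //=.
(* By [lE], [C.1] attains its maximum over the polyhedron at [xs], so the right-hand side can be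
   lowered to that value; optimality forbids a strict decrease. *)
have := Copt (C.1, dotrc C.1 xs); rewrite /= lerD2l lerN2; apply => // z Az.
rewrite /= {1}C1E dotrc_mulmx [X in _ <= X](_ : _ = (l *m b) 0 0).
  exact: ler_mulmx_row.
by rewrite C1E dotrc_mulmx.
Qed.

(** * Cuts along the segment and the directional normalization *)

Lemma violation_line (R : realType) (n : nat) (C : cutineq R n)
    (x v : 'cV[R]_n) (t : R) :
  violation C (x + t *: v) = violation C x + t * dotrc C.1 v.
Proof. by rewrite /violation {1}/dotrc mulmx_line addrAC. Qed.

(** Validity at the point with parameter [t] limits the violation at [xc] of every normalized
    competitor to [t]. Scaling [C] to slope -1 along the segment attains this bound. *)
Lemma directional_cut_tight (R : realType) (n : nat) (Q : set 'cV[R]_n)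
    (xc xh : 'cV[R]_n) (t : R) (C : cutineq R n) :
  0 < t -> Q (xc + t *: (xh - xc)) -> valid_cut Q C ->
  violation C (xc + t *: (xh - xc)) = 0 -> 0 < violation C xc ->
  directional_cut Q xc xh C.
Proof.
move=> t0 Qt Cval; rewrite violation_line => Ct Cxc.
exists (t / violation C xc); first exact: divr_gt0.
set a := t / _; have a0 : 0 < a by exact: divr_gt0.
have aC : a * violation C xc = t by rewrite divfK // gt_eqF.
have aS : a * dotrc C.1 (xh - xc) = -1.
  apply: (mulfI (lt0r_neq0 t0)); rewrite mulrCA mulrN1 -[in RHS]aC -mulrN.
  by congr (_ * _); lra.
split => [x Qx||D Dval].
- by rewrite /= dotrcZl ler_pM2l //; exact: Cval.
- by rewrite /directional_normalization /= dotrcZl aS normrN1.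
rewrite /directional_normalization /= ler_norml => /andP[Dt _].
have : violation D (xc + t *: (xh - xc)) <= 0 by rewrite subr_le0; exact: Dval.
rewrite violation_line => Dt0.
rewrite dotrcZl -mulrBr -/(violation C xc) aC -/(violation D xc).
have : t * -1 <= t * dotrc D.1 (xh - xc) by rewrite ler_pM2l.
lra.
Qed.

(** Ratio test: among the rows violated at [x], [i0] is the one that becomes satisfied last on the
    way to [y]. *)
Lemma segment_entry (R : realType) (m n : nat) (A : 'M[R]_(m, n))
    (b : 'cV[R]_m) (x y : 'cV[R]_n) :
  ~ (forall i, (A *m x) i 0 <= b i 0) -> (forall i, (A *m y) i 0 <= b i 0) ->
  exists (t : R) i0, [/\ 0 < t <= 1,
    forall i, (A *m (x + t *: (y - x))) i 0 <= b i 0,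
    (A *m (x + t *: (y - x))) i0 0 = b i0 0 & (A *m (y - x)) i0 0 < 0].
Proof.
move=> /existsNP[j /negP]; rewrite -ltNge => xj Ay.
have AB i : (A *m (y - x)) i 0 = (A *m y) i 0 - (A *m x) i 0.
  by rewrite mulmxBr mxE [X in _ + X]mxE.
pose r i := ((A *m x) i 0 - b i 0) / ((A *m x) i 0 - (A *m y) i 0).
pose P i := b i 0 < (A *m x) i 0.
have [i0 Pi0 rmax] := @arg_maxP _ _ _ j P r xj.
have d0 i : P i -> 0 < (A *m x) i 0 - (A *m y) i 0.
  by rewrite /P => Pi; have := Ay i; lra.
have rE i : P i -> r i * ((A *m x) i 0 - (A *m y) i 0) = (A *m x) i 0 - b i 0.
  by move=> Pi; rewrite divfK // gt_eqF ?d0.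
have r0 : 0 < r i0 by rewrite divr_gt0 ?d0 // subr_gt0.
have r1 : r i0 <= 1.
  by rewrite ler_pdivrMr ?d0 // mul1r; have := Ay i0; lra.
exists (r i0), i0; split; first by rewrite r0.
- move=> i; rewrite mulmx_line AB; have [Pi|] := boolP (P i).
    have : r i * ((A *m x) i 0 - (A *m y) i 0) <=
        r i0 * ((A *m x) i 0 - (A *m y) i 0).
      by rewrite ler_pM2r ?d0 //; exact: rmax.
    by rewrite (rE _ Pi); lra.
  rewrite /P -leNgt => xi; have := Ay i => yi.
  have : 0 <= r i0 * (b i 0 - (A *m y) i 0).
    by rewrite mulr_ge0 ?subr_ge0 // ltW.
  have : 0 <= (1 - r i0) * (b i 0 - (A *m x) i 0) by rewrite mulr_ge0 ?subr_ge0.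
  by lra.
- by rewrite mulmx_line AB; have := rE _ Pi0; lra.
by rewrite AB; have := d0 _ Pi0; lra.
Qed.

(** The violation is affine along the segment, positive at [t] and nonpositive at 1, so its slope is
    negative and it has a single zero. *)
Lemma cut_segm_meet (R : realType) (n : nat) (x y : 'cV[R]_n)
    (C : cutineq R n) (t : R) :
  0 <= t < 1 -> 0 < violation C (x + t *: (y - x)) -> violation C y <= 0 ->
  exists s : R, [/\ t < s <= 1, dotrc C.1 (y - x) < 0,
    violation C (x + s *: (y - x)) = 0 &
    segm x y `&` hyperplane C = [set x + s *: (y - x)]].
Proof.
move=> /andP[t0 t1]; rewrite violation_line.
have -> : violation C y = violation C x + dotrc C.1 (y - x).
  by rewrite -[dotrc _ _]mul1r -violation_line scale1r addrC subrK.
set v := violation C x; set d := dotrc C.1 _.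
move=> Ct Cy.
have d0 : d < 0.
  have : (1 - t) * d < 0 by lra.
  by rewrite pmulr_rlt0 // subr_gt0.
have sE : - v / d * d = - v by rewrite divfK // lt_eqF.
have lt_s s : (t < s) = (s * d < t * d) by rewrite ltr_nM2r.
exists (- v / d); split => //.
- by rewrite lt_s sE ler_ndivrMr // mul1r; lra.
- by rewrite violation_line -/d sE subrr.
apply/seteqP; split => [z [[u [_ ->]]] Cz|_ ->] /=.
  have : violation C (x + u *: (y - x)) = 0 by rewrite /violation Cz subrr.
  rewrite violation_line -/v -/d => vE.
  suff -> : u = - v / d by [].
  by apply: (mulIf (ltr0_neq0 d0)); rewrite sE; lra.
split.
  exists (- v / d); split => //; rewrite ler_ndivrMr // ler_ndivlMr //.
  by rewrite mul0r mul1r; have := mulr_ge0_le0 t0 (ltW d0); lra.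
apply/eqP; rewrite /hyperplane /= -subr_eq0 -/(violation C _) violation_line.
by rewrite -/v -/d sE subrr.
Qed.

(** * Step lengths and finite termination *)

Lemma exists_small_scale (R : realType) (m : nat) (k a : 'I_m -> R) :
  exists2 e : R, 0 < e &
    forall (s : R) i, 0 <= s < e -> 0 < a i -> s * k i < a i.
Proof.
pose S := 1 + \sum_i `|k i| / `|a i|.
have S0 : 0 < S by rewrite ltr_pwDl // sumr_ge0.
exists S^-1; first by rewrite invr_gt0.
move=> s i /andP[s0 se] ai.
have kS : `|k i| < S * a i.
  rewrite -ltr_pdivrMr // -{1}(gtr0_norm ai) /S (bigD1 i) //= addrCA ltrDl.
  by rewrite ltr_pwDl // sumr_ge0.
have [->|k0] := eqVneq (k i) 0; first by rewrite mulr0.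
apply: (@le_lt_trans _ _ (s * `|k i|)); first by rewrite ler_wpM2l ?ler_norm.
apply: (@lt_trans _ _ (S^-1 * `|k i|)); first by rewrite ltr_pM2r ?normr_gt0.
by rewrite ltr_pdivrMl.
Qed.

Theorem theorem3 (R : realType) (n : nat) (Q2 : set 'cV[R]_n)
    (xc xh : 'cV[R]_n) (N : 'rV[R]_n -> R) (sep : 'cV[R]_n -> cutineq R n)
    (hpoly : polyhedron Q2) (hbnd : bounded_set Q2)
    (hxc : ~ Q2 xc) (hxh : Q2 xh) (hN : is_norm N)
    (hsep : forall x', ~ Q2 x' ->
      fenchel_optimal Q2 (norm_normalization N) x' (sep x')) :
  exists (k : nat) (C : cutineq R n),
    iterative_method_returns Q2 sep xc xh k C /\ directional_cut Q2 xc xh C.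
Proof.
have [m [A [b Q2E]]] := hpoly; subst Q2.
set Q := [set _ | _] in hxc hxh hsep *.
have [ts [i0 [/andP[ts0 ts1] Qts Ai0 dA0]]] := segment_entry hxc hxh.
set v := xh - xc in Qts Ai0 dA0.
pose p (t : R) := xc + t *: v.
have pE (t : R) i : (A *m p t) i 0 = (A *m p ts) i 0 - (ts - t) * (A *m v) i 0.
  by rewrite !mulmx_line; lra.
have NQ (t : R) : t < ts -> ~ Q (p t).
  move=> tts /(_ i0); rewrite pE Ai0; apply/negP.
  by rewrite -ltNge ltrBDr gtrDl pmulr_rlt0 // subr_gt0.
have rowE i z : dotrc (row i A) z = (A *m z) i 0.
  by rewrite /dotrc -row_mul mxE.
have Na0 : 0 < N (row i0 A).
  apply: norm_gt0 => //; apply: contraTN dA0 => /eqP a0.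
  suff -> : (A *m v) i0 0 = 0 by rewrite ltxx.
  by rewrite -rowE a0 /dotrc mul0mx mxE.
(* Rate at which row [i0], scaled to norm 1, loses violation along the segment. *)
pose c := (N (row i0 A))^-1 * - (A *m v) i0 0.
have c0 : 0 < c by rewrite mulr_gt0 ?invr_gt0 // oppr_gt0.
have p0 : p 0 = xc by rewrite /p scale0r addr0.
pose f (t : R) := violation (sep (p t)) (p t).
have f_ge (t : R) : t < ts -> c * (ts - t) <= f t.
  move=> tts; have [_ _ Copt] := hsep _ (NQ _ tts).
  have := Copt ((N (row i0 A))^-1 *: row i0 A, (N (row i0 A))^-1 * b i0 0).
  rewrite /= dotrcZl rowE pE Ai0 -mulrBr addrAC subrr add0r -/(f t).
  have cE : c * (ts - t) = (N (row i0 A))^-1 * - ((ts - t) * (A *m v) i0 0).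
    by rewrite /c; ring.
  rewrite cE.
  apply => [z Qz|].
    by rewrite /= dotrcZl rowE ler_pM2l ?invr_gt0 //; exact: Qz.
  rewrite /norm_normalization /= norm_scale_ge0 ?invr_ge0 ?(ltW Na0) //.
  by rewrite mulVf // gt_eqF.
pose F := f 0.
have F0 : 0 < F by apply: lt_le_trans (f_ge _ ts0); rewrite mulr_gt0 // subr0.
(* The cut computed at [p t] also competes in the problem at [xc], whose optimal value is [F]. *)
have v_le_F (t : R) : t < ts -> violation (sep (p t)) xc <= F.
  move=> tts; have [_ _ Copt] := hsep _ (NQ _ ts0).
  have [Cval CN _] := hsep _ (NQ _ tts).
  by rewrite /F /f p0; rewrite p0 in Copt; exact: Copt.
(* With the bound [F / ts * (ts - t)] on the violation at [p t], the smallness condition of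
   [optimal_cut_tight] becomes [(ts - t) * k i < a i] for these [k] and [a]. *)
have [e e0 eP] := exists_small_scale
  (fun i => N (row i A) * (F / ts) - (A *m v) i 0)
  (fun i => b i 0 - (A *m p ts) i 0).
have step (t : R) : 0 <= t < ts -> exists s : R, [/\ t < s <= ts,
    segm xc xh `&` hyperplane (sep (p t)) = [set p s],
    s * (c * (ts - t)) <= (s - t) * F, ts - t < e -> s = ts &
    s = ts -> directional_cut Q xc xh (sep (p t))].
  move=> /andP[t0 tts]; have Copt := hsep _ (NQ _ tts).
  have ft := f_ge _ tts; have vF := v_le_F _ tts.
  have ft0 : 0 < f t by apply: lt_le_trans ft; rewrite mulr_gt0 // subr_gt0.
  move: ft ft0 vF Copt; rewrite /f; set C := sep (p t).
  move=> ft ft0 vF Copt; have [Cval CN _] := Copt.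
  have Cle z : Q z -> violation C z <= 0.
    by move=> Qz; rewrite subr_le0; exact: Cval.
  have t01 : 0 <= t < 1 by rewrite t0 (lt_le_trans tts).
  have [s [/andP[lt_ts s1] d0 Cs meet]] := cut_segm_meet t01 ft0 (Cle _ hxh).
  have := Cle _ Qts; rewrite violation_line => Cts.
  rewrite violation_line -/v in Cs d0 Cts.
  have Ct := ft; rewrite violation_line in Ct.
  move: ft0; rewrite violation_line => ft0.
  have s_le : s <= ts by rewrite -(ler_nM2r d0); lra.
  have sE : violation C (p ts) = 0 -> s = ts.
    rewrite violation_line => Cts0.
    by apply: (mulIf (ltr0_neq0 d0)); lra.
  exists s; split => //; first by rewrite lt_ts.
  (* The violation vanishes at [s], so at [t] it is [(s - t) / s] times its value at [xc]. *)
  - apply: (@le_trans _ _ (s * (violation C xc + t * dotrc C.1 v))).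
      by rewrite ler_wpM2l // ltW // (le_lt_trans t0).
    have -> : s * (violation C xc + t * dotrc C.1 v) = (s - t) * violation C xc.
      have : t * (violation C xc + s * dotrc C.1 v) = 0 by rewrite Cs mulr0.
      by rewrite mulrBl mulrDr; lra.
    by rewrite ler_wpM2l // subr_ge0 ltW.
  - move=> small; apply: sE; apply: optimal_cut_tight Copt _ => // i ai.
    have s_lt : 0 <= ts - t < e by rewrite subr_ge0 ltW.
    have := eP _ i s_lt; rewrite subr_gt0 => /(_ ai).
    rewrite [in X in _ -> X]pE.
    (* An affine function at most [F] at 0 and at most 0 at [ts] lies below the chord. *)
    have : N (row i A) * violation C (p t) <= N (row i A) * (F / ts * (ts - t)).
      rewrite ler_wpM2l ?norm_ge0 // -mulrA [_^-1 * _]mulrC mulrA.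
      rewrite ler_pdivlMr //.
      have : t * (violation C xc + ts * dotrc C.1 v) <= 0.
        by rewrite mulr_ge0_le0.
      have : (ts - t) * violation C xc <= (ts - t) * F.
        by rewrite ler_wpM2l // subr_ge0 ltW.
      rewrite violation_line; lra.
    lra.
  - move=> sts; apply: (@directional_cut_tight _ _ _ _ _ ts) => //.
      by rewrite violation_line -/v -sts.
    have : t * dotrc C.1 v <= 0 by rewrite mulr_ge0_le0 // ltW.
    lra.
(* Until [ts - t < e], each step that misses [ts] advances by at least [t1 * (c * e) / F]; [j]
   bounds the number of such steps. *)
have run j : forall (t t1 : R) C0, 0 < t1 -> t1 <= t < ts ->
    ts - t < e + (t1 * (c * e) / F) *+ j ->
    exists k C, loop Q sep xc xh (p t) C0 k (Some C) /\
      directional_cut Q xc xh C.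
  elim: j => [|j IHj] t t1 C0 t1p /andP[t1t tts] tj.
    have t0ts : 0 <= t < ts by rewrite tts andbT ltW // (lt_le_trans t1p).
    have [s [_ meet _ sE sC]] := step _ t0ts.
    have {}sE : s = ts by apply: sE; rewrite mulr0n addr0 in tj.
    exists 1%N, (sep (p t)); split; last exact: sC.
    apply: loop_iter meet _; first exact: NQ.
    by rewrite sE; apply: loop_stop.
  have t0ts : 0 <= t < ts by rewrite tts andbT ltW // (lt_le_trans t1p).
  have [s [/andP[lt_ts s_le] meet sF sE sC]] := step _ t0ts.
  have [sts|s_neq] := eqVneq s ts.
    exists 1%N, (sep (p t)); split; last exact: sC.
    apply: loop_iter meet _; first exact: NQ.
    by rewrite sts; apply: loop_stop.
  have s_lt : s < ts by rewrite lt_neqAle s_neq.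
  have te : e <= ts - t.
    by rewrite leNgt; exact: contra_neqN sE s_neq.
  have sd : t1 * (c * e) / F <= s - t.
    rewrite ler_pdivrMr // (le_trans _ sF) //.
    have t1s : t1 <= s by rewrite (le_trans t1t) // ltW.
    by apply: ler_pM => //; rewrite ?ler_pM2l ?(ltW t1p) // ltW // mulr_gt0.
  have [|//|k [C [Ck Cd]]] := IHj s t1 (Some (sep (p t))) t1p.
  - by rewrite s_lt andbT (le_trans t1t) // ltW.
  - by move: tj; rewrite mulrS; lra.
  exists k.+1, C; split => //.
  by apply: loop_iter meet Ck; exact: NQ.
(* The step bound needs a positive [t1], so the iteration from 0 is treated apart; its endpoint [s]
   then serves as [t1]. *)
have [|s [/andP[s0 s_le] meet _ _ sC]] := step 0; first by rewrite lexx ts0.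
have iter0 k C : loop Q sep xc xh (p s) (Some (sep (p 0))) k (Some C) ->
    iterative_method_returns Q sep xc xh k.+1 C.
  move=> Ck; rewrite /iterative_method_returns -[X in loop _ _ _ _ X]p0.
  by apply: loop_iter meet Ck; exact: NQ.
have [sts|s_neq] := eqVneq s ts.
  exists 1%N, (sep (p 0)); split; last exact: sC.
  by apply: iter0; rewrite sts; apply: loop_stop.
have s_lt : s < ts by rewrite lt_neqAle s_neq.
have eta0 : 0 < s * (c * e) / F.
  by exact: divr_gt0 (mulr_gt0 s0 (mulr_gt0 c0 e0)) F0.
(* This many steps of minimal length exceed [ts] in total. *)
have [||k [C [Ck Cd]]] :=
    run (Num.truncn (ts / (s * (c * e) / F))).+1 s s (Some (sep (p 0))) s0.
- by rewrite lexx s_lt.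
- rewrite -mulr_natr mulrC; set r := _ / F; set k := _%:R.
  have : ts < k * r by rewrite -ltr_pdivrMr // truncnS_gt.
  by lra.
by exists k.+1, C; split => //; exact: iter0.
Qed.
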